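(* Let $\mathbf G=\{G_1,G_2,\ldots\}$ be a countable family of countable sets satisfying conditions (g$_1$) and (g$_2$) of the context. Let $\mathfrak T$ be the locally convex topology on $\mathcal V_{\mathcal S}$ generated by the seminorms $p_k(w):=\sum_{g\in G_k}|w(g)|$, $k=1,2,\ldots$ Then the Mackey topology $\mathfrak T_{\mathrm m}(\mathcal V_{\mathcal S},\mathcal V'_{\mathcal S})$ is finer than (that is, not weaker than) $\mathfrak T$, and it coincides with $\mathfrak T$ on every $\mathfrak T_{\mathrm b}(\mathcal V_{\mathcal S},\mathcal V'_{\mathcal S})$-bounded subset of $\mathcal V_{\mathcal S}$.
   Context: $\mathbf G=\{G_1,G_2,\ldots\}$ is a (finite or infinite) countable family of countable sets, which may have non-empty intersections. $G$ is the simple graph whose vertex set is $\bigcup_kG_k$, two distinct vertices being joined by an edge if and only if they belong to the same set $G_k$ for some $k$. $\mathcal W$ is the linear space of real-valued functions on the vertex set of $G$. $\mathcal S^\emptyset$ is the set of all non-negative $w\in\mathcal W$ with $\sum_{g\in G_k}w(g)\le1$ for every $k$. $\mathcal V_{\mathcal S}$ is the normal cover of the linear span of $\mathcal S^\emptyset$, i.e. the set of all $\tilde w\in\mathcal W$ such that, for some $w$ in this linear span, $|\tilde w(g)|\le|w(g)|$ for all $g$. A path $g_0\to g_1\to\dots\to g_l$ in $G$ is a sequence of vertices in which consecutive vertices are joined by an edge. A path is a cycle if $g_0=g_l$ and the number of distinct vertices $g_j$ is at least $3$. A path is admissible if no three adjacent (i.e. consecutive) vertices of it belong to the same set $G_k$;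 for a cycle $g_0\to\dots\to g_l=g_0$ adjacency is understood cyclically (so the triple $g_{l-1},g_0,g_1$ is included), and its number of vertices is $l$. Conditions: (g$_1$) every vertex of $G$ belongs to at most two of the sets $G_k$; (g$_2$) every admissible cycle in $G$ has an even number of vertices. For a linear subspace $\mathcal V\subseteq\mathcal W$ containing all finitely supported functions, $\mathcal V'$ is the space of all $w'\in\mathcal W$ with $\sum_g|w(g)w'(g)|<\infty$ for all $w\in\mathcal V$, $\langle w,w'\rangle:=\sum_gw(g)w'(g)$, and $\mathfrak T_{\mathrm w}(\mathcal V',\mathcal V)$ is the weak topology on $\mathcal V'$ defined by the functionals $\langle w,\cdot\rangle$, $w\in\mathcal V$. The Mackey topology $\mathfrak T_{\mathrm m}(\mathcal V,\mathcal V')$ (respectively, the strong topology $\mathfrak T_{\mathrm b}(\mathcal V,\mathcal V')$) on $\mathcal V$ is generated by the seminorms $w\mapsto\sup_{w'\in\Omega'}|\langle w,w'\rangle|$, where $\Omega'$ runs over all absolutely convex $\mathfrak T_{\mathrm w}(\mathcal V',\mathcal V)$-compact (respectively, over all $\mathfrak T_{\mathrm w}(\mathcal V',\mathcal V)$-bounded) subsets of $\mathcal V'$. *)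

(* Defs.v *)
From HB Require Import structures.
From mathcomp Require Import all_boot all_order all_algebra.
From mathcomp Require Import all_classical all_reals all_analysis.

Set Implicit Arguments.
Unset Strict Implicit.
Unset Printing Implicit Defensive.

Import Order.TTheory GRing.Theory Num.Theory.
Import numFieldNormedType.Exports.

Local Open Scope classical_set_scope.
Local Open Scope ring_scope.

(* The family is the set [GG] of its members; [V] is meant to be exactly their
   union, i.e. the vertex set. *)
Section Graph.
Context {V : choiceType}.
Variable GG : set (set V).

Definition edge : rel V :=
  fun x y => `[< x != y /\ exists2 A, GG A & A x /\ A y >].

(* The closed path g_0 -> g_1 -> ... -> g_l = g_0 is encoded by the sequence
   [:: g_0; ...; g_(l-1)], whose size is its number of vertices l. *)
Definition graph_cycle (c : seq V) : Prop :=
  path.cycle edge c /\ (3 <= size (undup c))%N.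

(* The cyclically consecutive triples of [c] are the first three entries of its
   rotations. *)
Definition admissible_cycle (c : seq V) : Prop :=
  graph_cycle c /\
  forall i x y z s, rot i c = [:: x, y, z & s] ->
    forall A, GG A -> ~ [/\ A x, A y & A z].

Definition cond_g1 : Prop := forall v, ([set A | GG A /\ A v] #<= `I_2)%card.

Definition cond_g2 : Prop := forall c, admissible_cycle c -> ~~ odd (size c).

End Graph.

Section SeminormTopology.
Context {R : realType}.

(* A copy of [E] carrying the topology generated by the family [P]. *)
Definition seminorm_top (E : lmodType R) (P : set (E -> R)) : Type := E.

Definition seminorm_open (E : lmodType R) (P : set (E -> R)) : set (set E) :=
  [set O | forall x, O x -> exists F e,
    [/\ finite_set F, F `<=` P, 0 < e &
        [set y | forall p, F p -> p (y - x) < e] `<=` O]].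

Section Instance.
Variables (E : lmodType R) (P : set (E -> R)).

Lemma seminorm_openT : seminorm_open P setT.
Proof. by move=> x _; exists set0, 1; split => //; exact: ltr01. Qed.

Lemma seminorm_openI : setI_closed (seminorm_open P).
Proof.
move=> A B oA oB x [/oA[F [e [finF FP e0 FA]]] /oB[F' [e' [finF' FP' e0' FB]]]].
exists (F `|` F'), (Num.min e e'); split.
- by rewrite finite_setU.
- by rewrite subUset.
- by rewrite lt_min e0.
- move=> y /= yF; split.
  + by apply: FA => p Fp; have := yF p (or_introl Fp); rewrite lt_min => /andP[].
  + by apply: FB => p Fp; have := yF p (or_intror Fp); rewrite lt_min => /andP[].
Qed.

Lemma seminorm_open_bigU (I : Type) (f : I -> set E) :
  (forall i, seminorm_open P (f i)) -> seminorm_open P (\bigcup_i f i).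
Proof.
move=> of_ x [i _ fx]; have [F [e [finF FP e0 Ff]]] := of_ i x fx.
by exists F, e; split => // y /Ff fy; exists i.
Qed.

HB.instance Definition _ := GRing.Lmodule.on (seminorm_top P).
HB.instance Definition _ := isOpenTopological.Build (seminorm_top P)
  seminorm_openT seminorm_openI seminorm_open_bigU.

End Instance.

Definition opens (E : lmodType R) (P : set (E -> R)) : set (set E) :=
  @open (seminorm_top P).

Definition traces (E : Type) (T : set (set E)) (B : set E) : set (set E) :=
  [set O `&` B | O in T].

(* von Neumann boundedness: [B] is absorbed by every neighbourhood of 0. *)
Definition bounded_for (E : lmodType R) (P : set (E -> R)) (B : set E) : Prop :=
  forall U : set (seminorm_top P), nbhs (0 : seminorm_top P) U ->
    exists2 r : R, 0 < r &
      forall a : R, r <= `|a| -> B `<=` [set a *: x | x in U].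

Definition absolutely_convex (E : lmodType R) (K : set E) : Prop :=
  forall (x y : E) (a b : R),
    K x -> K y -> `|a| + `|b| <= 1 -> K (a *: x + b *: y).

Section DualPair.
Variables (E E' : lmodType R) (b : E -> E' -> R).

Definition weak_seminorms : set (E' -> R) :=
  [set (fun w' => `|b w w'|) | w in [set: E]].

(* The real-valued [sup] is the genuine supremum for the sets used below, which
   are weakly bounded; for [K = set0] it is 0, a harmless extra seminorm. *)
Definition polar_seminorm (K : set E') (w : E) : R :=
  sup [set `|b w w'| | w' in K].

Definition mackey_seminorms : set (E -> R) :=
  [set polar_seminorm K | K in [set K : set E' | absolutely_convex K /\
     compact (K : set (seminorm_top weak_seminorms))]].

Definition strong_seminorms : set (E -> R) :=
  [set polar_seminorm K | K in bounded_for weak_seminorms].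

End DualPair.
End SeminormTopology.

(* A linear subspace as a type. *)
Record subsp (R : realType) (W : lmodType R) (S : submodClosed W) :=
  Subsp { subsp_val : W ; _ : subsp_val \in S }.

Section SubspInstances.
Context (R : realType) (W : lmodType R) (S : submodClosed W).
HB.instance Definition _ := [isSub of subsp S for @subsp_val R W S].
HB.instance Definition _ := [Choice of subsp S by <:].
HB.instance Definition _ := [SubChoice_isSubLmodule of subsp S by <:].
End SubspInstances.

Section FunctionSpaces.
Context {R : realType} {V : choiceType}.
Local Notation W := (V -> R).

Definition substoch (GG : set (set V)) : set W :=
  [set w | (forall g, 0 <= w g) /\
     forall A, GG A -> (\esum_(g in A) (w g)%:E <= 1)%E].

Definition lin_span (S : set W) : set W :=
  [set w | exists n (c : 'I_n -> R) (s : 'I_n -> W),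
     (forall i, S (s i)) /\ w = \sum_(i < n) c i *: s i].

Definition normal_cover (S : set W) : set W :=
  [set v | exists2 w, S w & forall g, `|v g| <= `|w g|].

Definition VS (GG : set (set V)) : {pred W} :=
  mem (normal_cover (lin_span (substoch GG))).

Definition kdual (S : {pred W}) : {pred W} :=
  mem [set w' : W | forall w : W, w \in S ->
         summable [set: V] (fun g => (w g * w' g)%:E)].

(* Sum of an absolutely summable family: positive part minus negative part. *)
Definition abs_sum (f : V -> R) : R :=
  fine (\esum_(g in [set: V]) (f^\+ g)%:E) -
  fine (\esum_(g in [set: V]) (f^\- g)%:E).

Definition pairing (w w' : W) : R := abs_sum (fun g => w g * w' g).

Lemma VS_submod_closed (GG : set (set V)) : submod_closed (VS GG).
Proof.
split.
  apply/mem_set; exists 0 => //.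
  by exists 0%N, (fun=> 0), (fun=> 0); split; [case | rewrite big_ord0].
move=> a f g /set_mem[_ [m [c [s [Ss ->]]]] fs].
move=> /set_mem[_ [n [d [t [St ->]]]] gt].
apply/mem_set.
pose C (k : 'I_(m + n)) := match fintype.split k with
  | inl i => `|a| * `|c i| | inr j => `|d j| end.
pose U (k : 'I_(m + n)) := match fintype.split k with
  | inl i => s i | inr j => t j end.
exists (\sum_(k < m + n) C k *: U k).
  by exists (m + n)%N, C, U; split => // k; rewrite /U; case: (fintype.split k).
move=> x.
have domE p (e : 'I_p -> R) (u : 'I_p -> W) : (forall i, substoch GG (u i)) ->
    `|(\sum_(i < p) e i *: u i) x| <= \sum_(i < p) `|e i| * u i x.
  move=> Su; rewrite fct_sumE; apply: le_trans (ler_norm_sum _ _ _) _.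
  by apply: ler_sum => i _; rewrite normrM (ger0_norm ((Su i).1 x)).
rewrite big_split_ord /=.
have -> : \sum_(i < m) C (lshift n i) *: U (lshift n i) =
    \sum_(i < m) (`|a| * `|c i|) *: s i.
  by apply: eq_bigr => i _; rewrite /C /U (unsplitK (inl i)).
have -> : \sum_(i < n) C (rshift m i) *: U (rshift m i) =
    \sum_(i < n) `|d i| *: t i.
  by apply: eq_bigr => i _; rewrite /C /U (unsplitK (inr i)).
apply: le_trans (ler_norm _); rewrite !fctE.
apply: le_trans (ler_normD _ _) _; apply: lerD.
  rewrite normrM fct_sumE.
  apply: le_trans (ler_wpM2l (normr_ge0 a) (le_trans (fs x) (domE _ _ _ Ss))) _.
  by rewrite mulr_sumr; apply: ler_sum => i _; rewrite mulrA.
by rewrite fct_sumE; exact: le_trans (gt x) (domE _ _ _ St).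
Qed.

HB.instance Definition _ GG := GRing.isSubmodClosed.Build R W (VS GG)
  (VS_submod_closed GG).

Lemma kdual_submod_closed (S : {pred W}) : submod_closed (kdual S).
Proof.
split.
  apply/mem_set => w _; rewrite /summable esum1 ?ltry// => i _.
  by rewrite mulr0 abse0.
move=> a f g /set_mem fS /set_mem gS; apply/mem_set => w wS.
rewrite /summable.
apply: (@le_lt_trans _ _ (\esum_(x in [set: V])
   (`|a|%:E * `|(w x * f x)%:E| + `|(w x * g x)%:E|))%E).
  apply: le_esum => x _; rewrite -EFinM -EFinD lee_fin.
  rewrite !fctE mulrDr; apply: le_trans (ler_normD _ _) _.
  by rewrite lerD2r mulrCA normrM.
rewrite esumD; [|by move=> x _; rewrite mule_ge0|by move=> x _].
apply: lte_add_pinfty; last exact: gS.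
have := fS w wS; rewrite summableE => /fineK fE.
apply: (@le_lt_trans _ _
  (`|a|%:E * \esum_(x in [set: V]) `|(w x * f x)%:E|)%E); last first.
  by rewrite -fE -EFinM ltry.
apply: ge_ereal_sup => _ [X [finX XI] <-].
rewrite -ge0_mule_fsumr; last by move=> x; exact: abse_ge0.
by apply: lee_wpmul2l => //; apply: ereal_sup_ubound; exists X.
Qed.

HB.instance Definition _ S := GRing.isSubmodClosed.Build R W (kdual S)
  (kdual_submod_closed S).

End FunctionSpaces.

Notation VS_space R GG := (subsp (@VS R _ GG)).
Notation VS_dual R GG := (subsp (kdual (@VS R _ GG))).

Section Seminorms.
Context {R : realType} {V : choiceType}.
Variable GG : set (set V).

Definition VS_pairing (w : VS_space R GG) (w' : VS_dual R GG) : R :=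
  pairing (val w) (val w').

Definition pk (A : set V) (w : VS_space R GG) : R :=
  fine (\esum_(g in A) (`|(val w : V -> R) g|)%:E).

Definition p_seminorms : set (VS_space R GG -> R) := [set pk A | A in GG].

End Seminorms.

Arguments VS_pairing R {V} GG.
Arguments p_seminorms R {V} GG.

(* Main.v *)
Require Import Defs.
From mathcomp Require Import all_boot all_order all_algebra.
From mathcomp Require Import all_classical all_reals all_analysis.
From mathcomp Require Import finmap ring lra.

Import Order.TTheory GRing.Theory Num.Theory.
Import numFieldNormedType.Exports.

Local Open Scope classical_set_scope.
Local Open Scope ring_scope.

(** A function w belongs to the space exactly when the sums of |w| over the members
    of the family are bounded by a common constant ([mem_VS]).

    The Mackey topology is finer because each seminorm [pk A] is the polar seminorm
    of the functions bounded by the indicator of A ([polar_unit_ball]), and these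
    form an absolutely convex, weakly compact set ([unit_ball_compact]).

    A strongly bounded set B has a uniform bound C on its sums, as the union of these
    unit balls is weakly bounded ([strongly_bounded_sums]). The topologies coincide
    on B if, for K weakly compact, the polar seminorm of K is continuous at the
    points of B for the topology of the [pk A] restricted to B
    ([nbhs_mackey_ball]). As the family is countable, this concerns sequences: if
    the sums of |w n| over each A are bounded by a constant and tend to 0 as n
    grows, then w n tends to 0 uniformly on K ([uniformly_null]).

    That is a gliding hump argument in the style of the Schur theorem. Finite
    truncations of a subsequence of w, with disjoint supports, can be chosen so that
    each is tiny on the members of the family that meet the preceding ones. As each
    vertex lies in at most two members, a finite set meets finitely many of them, so
    this is possible; the superposition v of the humps then again has bounded sums
    ([gliding_hump]). Applied with a fixed z of the dual, this shows that the sum of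
    |w n z| tends to 0 ([kdual_null]). Applied with elements y n of K on which w n
    is not small, and a weak cluster point y0 of the sequence y, it produces humps
    with negligible interactions ([good_hump_exists]), and hence a v whose pairing
    with y n - y0 stays away from 0 along the chosen indices; this contradicts the
    existence of a weak cluster point of the y n along these indices. *)

(** * Finite sums and unordered summation *)

Section FiniteSums.
Context {R : realType} {V : choiceType}.
Implicit Types (D : set V) (f g h : V -> R) (s t : seq V).

(** The bound on the sum of |f| over D is stated through finite duplicate-free
    sequences, so that the whole combinatorial argument stays in R. *)
Definition sum_le D f (c : R) : Prop :=
  forall s, uniq s -> (forall x, x \in s -> D x) -> \sum_(x <- s) `|f x| <= c.

Definition abs_summable f : Prop := exists c, sum_le setT f c.

Lemma big_filterID f s t :
  \sum_(x <- s) f x =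
  \sum_(x <- [seq x <- s | x \in t]) f x +
  \sum_(x <- [seq x <- s | x \notin t]) f x.
Proof. by rewrite (bigID (mem t)) /= !big_filter. Qed.

Lemma big_subseqID f s t : uniq s -> uniq t -> {subset s <= t} ->
  \sum_(x <- t) f x =
  \sum_(x <- s) f x + \sum_(x <- [seq x <- t | x \notin s]) f x.
Proof.
move=> us ut st; rewrite (big_filterID f t s); congr (_ + _).
apply: perm_big; apply: uniq_perm; rewrite ?filter_uniq// => x.
by rewrite mem_filter; case: (boolP (x \in s)) => // /st ->.
Qed.

Lemma ler_sum_subset f s t : (forall x, 0 <= f x) -> uniq s -> uniq t ->
  {subset s <= t} -> \sum_(x <- s) f x <= \sum_(x <- t) f x.
Proof.
by move=> f0 us ut st; rewrite (big_subseqID f s t)// lerDl sumr_ge0.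
Qed.

Lemma esum_leP D h (c : R) : (\esum_(g in D) (h g)%:E <= c%:E)%E <->
  forall s, uniq s -> (forall x, x \in s -> D x) -> \sum_(x <- s) h x <= c.
Proof.
split=> [hc s us sD|H].
  rewrite -lee_fin; apply: le_trans hc; apply: esum_ge.
  exists [set` s]; first by split; [exact: finite_seq | move=> x /= /sD].
  by rewrite -fsbig_seq// sumEFin.
apply: ge_ereal_sup => _ [X [finX XD] <-].
rewrite fsbig_finite//= sumEFin lee_fin; apply: H; first exact: fset_uniq.
by move=> x; rewrite in_fset_set// => /set_mem /XD.
Qed.

Lemma sum_le_esum D f c : sum_le D f c <->
  (\esum_(g in D) (`|f g|)%:E <= c%:E)%E.
Proof. by split => [H|/esum_leP//]; apply/esum_leP. Qed.

Lemma sum_le_dom D f g c : (forall x, D x -> `|f x| <= `|g x|) ->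
  sum_le D g c -> sum_le D f c.
Proof.
move=> fg H s us sD; apply: le_trans (H _ us sD).
by rewrite big_seq [leRHS]big_seq; apply: ler_sum => x /sD /fg.
Qed.

Lemma sum_leD D f g c d : sum_le D f c -> sum_le D g d ->
  sum_le D (fun x => f x + g x) (c + d).
Proof.
move=> fc gd s us sD; apply: le_trans (lerD (fc s us sD) (gd s us sD)).
by rewrite -big_split; apply: ler_sum => x _; exact: ler_normD.
Qed.

Lemma sum_leZ D f c a : sum_le D f c -> sum_le D (fun x => a * f x) (`|a| * c).
Proof.
move=> fc s us sD; apply: le_trans (ler_wpM2l (normr_ge0 a) (fc s us sD)).
by rewrite mulr_sumr; apply: ler_sum => x _; rewrite normrM.
Qed.

Lemma sum_leT D f c : sum_le D f c -> sum_le D (fun x => `|f x|) c.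
Proof. by apply: sum_le_dom => x _; rewrite normr_id. Qed.

Lemma sum_le_pt D f c x : sum_le D f c -> D x -> `|f x| <= c.
Proof.
move=> /(_ [:: x] isT) + Dx; rewrite big_seq1; apply.
by move=> y; rewrite inE => /eqP ->.
Qed.

Lemma abs_summableP f : abs_summable f <->
  summable [set: V] (fun x => (f x)%:E).
Proof.
rewrite /summable; split=> [[c fc]|].
  by move/sum_le_esum : fc => /le_lt_trans -> //; rewrite ltry.
move=> fin; exists (fine (\esum_(g in [set: V]) (`|f g|)%:E)).
apply/sum_le_esum; rewrite fineK// fin_numElt (lt_le_trans (ltNyr 0))//=.
by apply: esum_ge0 => x _; rewrite lee_fin.
Qed.

Lemma esum_approx h c : (forall x, 0 <= h x) -> sum_le setT h c ->
  forall e : R, 0 < e -> exists s0, uniq s0 /\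
    forall s, uniq s -> {subset s0 <= s} ->
    `|\sum_(x <- s) h x - fine (\esum_(g in [set: V]) (h g)%:E)| <= e.
Proof.
move=> h0 hc e e0; set E := esum _ _.
have E0 : (0 <= E)%E by apply: esum_ge0 => x _; rewrite lee_fin.
have Ec : (E <= c%:E)%E.
  by apply/esum_leP => s us sT; rewrite -(eq_bigr _ (fun i _ => ger0_norm (h0 i)));
     exact: hc.
have Ef : E \is a fin_num.
  by rewrite fin_numElt (lt_le_trans (ltNyr 0) E0) (le_lt_trans Ec)// ltry.
have upp s : uniq s -> \sum_(x <- s) h x <= fine E.
  by move=> us; apply: (proj1 (esum_leP setT h (fine E))) => //; rewrite fineK.
suff [s0 us0 Hs0] : exists2 s0, uniq s0 & fine E - e <= \sum_(x <- s0) h x.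
  exists s0; split=> // s us ss; have := upp _ us.
  by have := ler_sum_subset h _ _ h0 us0 us ss; rewrite ler_norml; lra.
apply: contrapT => /forall2NP H.
suff : (E <= (fine E - e)%:E)%E by rewrite -{1}(fineK Ef) lee_fin; lra.
apply/esum_leP => s us _; have [//|/negP] := H s.
by rewrite -ltNge => /ltW.
Qed.

(** Unordered summation: the finite sums of f converge to [abs_sum f] along the
    directed set of finite subsets. Every later fact about [abs_sum] is derived
    from this limit. *)
Lemma abs_sum_approx f : abs_summable f ->
  forall e : R, 0 < e -> exists s0, uniq s0 /\
    forall s, uniq s -> {subset s0 <= s} ->
    `|\sum_(x <- s) f x - abs_sum f| <= e.
Proof.
move=> [c fc] e e0.
have pc : sum_le setT (f^\+) c.
  apply: sum_le_dom fc => x _; rewrite ger0_norm ?funrpos_ge0//.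
  by rewrite /funrpos ge_max ler_norm normr_ge0.
have nc : sum_le setT (f^\-) c.
  apply: sum_le_dom fc => x _; rewrite ger0_norm ?funrneg_ge0//.
  by rewrite /funrneg ge_max -normrN ler_norm normr_ge0.
have e2 : 0 < e / 2 by rewrite divr_gt0.
have [s1 [us1 H1]] := esum_approx _ _ (@funrpos_ge0 _ _ f) pc _ e2.
have [s2 [us2 H2]] := esum_approx _ _ (@funrneg_ge0 _ _ f) nc _ e2.
exists (undup (s1 ++ s2)); split; first exact: undup_uniq.
move=> s us sub.
have /(H1 _ us) S1 : {subset s1 <= s}.
  by move=> x xs; apply: sub; rewrite mem_undup mem_cat xs.
have /(H2 _ us) S2 : {subset s2 <= s}.
  by move=> x xs; apply: sub; rewrite mem_undup mem_cat xs orbT.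
rewrite /abs_sum.
have -> : \sum_(x <- s) f x = \sum_(x <- s) f^\+ x - \sum_(x <- s) f^\- x.
  rewrite -sumrB; apply: eq_bigr => x _.
  by have := congr1 (fun h => h x) (funrposBneg f).
move: S1 S2; rewrite !ler_norml => /andP[? ?] /andP[? ?].
by apply/andP; split; lra.
Qed.

Lemma abs_summable_tail f : abs_summable f ->
  forall e : R, 0 < e -> exists s0, uniq s0 /\
    forall s, uniq s -> (forall x, x \in s -> x \notin s0) ->
    \sum_(x <- s) `|f x| <= e.
Proof.
move=> [c fc] e e0; have e2 : 0 < e / 2 by rewrite divr_gt0.
have [|s0 [us0 H]] := abs_sum_approx (fun x => `|f x|) _ _ e2.
  by exists c; exact: sum_leT.
exists s0; split=> // s us ss.
have us0s : uniq (s0 ++ s).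
  by rewrite cat_uniq us0 us andbT; apply/hasPn => x /ss.
have sub : {subset s0 <= s0 ++ s} by move=> x xs; rewrite mem_cat xs.
have := H _ us0s sub; have := H s0 us0 (fun _ => id); rewrite big_cat /=.
by rewrite !ler_norml => /andP[? ?] /andP[? ?]; lra.
Qed.

(** A bound valid for all large finite sums passes to the limit. *)
Lemma abs_sum_near f s0 (b c : R) : abs_summable f -> uniq s0 ->
  (forall s, uniq s -> {subset s0 <= s} -> `|\sum_(x <- s) f x - b| <= c) ->
  `|abs_sum f - b| <= c.
Proof.
move=> sf us0 H; apply/ler_addgt0Pr => e e0.
have [s1 [us1 H1]] := abs_sum_approx f sf _ e0.
pose s := undup (s0 ++ s1); have us : uniq s by exact: undup_uniq.
have {}H : `|\sum_(x <- s) f x - b| <= c.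
  by apply: H => // x xs; rewrite mem_undup mem_cat xs.
have {}H1 : `|\sum_(x <- s) f x - abs_sum f| <= e.
  by apply: H1 => // x xs; rewrite mem_undup mem_cat xs orbT.
move: H H1; rewrite !ler_norml => /andP[? ?] /andP[? ?].
by apply/andP; split; lra.
Qed.

Lemma abs_sum_le f c : sum_le setT f c -> `|abs_sum f| <= c.
Proof.
move=> fc; have := @abs_sum_near f [::] 0 c; rewrite subr0; apply => //.
  by exists c.
by move=> s us _; rewrite subr0; apply: le_trans (ler_norm_sum _ _ _) (fc _ us _).
Qed.

Lemma abs_sum_finite f s : uniq s -> (forall x, x \notin s -> f x = 0) ->
  abs_sum f = \sum_(x <- s) f x.
Proof.
move=> us fs.
have eqs t : uniq t -> {subset s <= t} -> \sum_(x <- t) f x = \sum_(x <- s) f x.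
  move=> ut st; rewrite (big_subseqID f s t)// [X in _ + X]big1_seq ?addr0//.
  by move=> x /=; rewrite mem_filter => /andP[/fs].
apply/eqP; rewrite -subr_eq0 -normr_le0; apply: (abs_sum_near f s) => //.
  exists (\sum_(x <- s) `|f x|) => t ut _.
  rewrite (big_filterID (fun x => `|f x|) t s) [X in _ + X]big1_seq ?addr0.
    by apply: ler_sum_subset; rewrite ?filter_uniq// => x;
       rewrite mem_filter => /andP[].
  by move=> x /=; rewrite mem_filter => /andP[/fs ->]; rewrite normr0.
by move=> t ut st; rewrite eqs// subrr normr0.
Qed.

Lemma abs_sum_linear f g a : abs_summable f -> abs_summable g ->
  abs_sum (fun x => a * f x + g x) = a * abs_sum f + abs_sum g.
Proof.
move=> sf sg.
have sfg : abs_summable (fun x => a * f x + g x).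
  have [c fc] := sf; have [d gd] := sg.
  by exists (`|a| * c + d); apply: sum_leD => //; exact: sum_leZ.
apply/eqP; rewrite -subr_eq0 -normr_le0; apply/ler_addgt0Pr => e e0; rewrite add0r.
have a1 : 0 < 2 * (1 + `|a|) by rewrite mulr_gt0// ltr_pwDl.
have e1 : 0 < e / (2 * (1 + `|a|)) by rewrite divr_gt0.
have [s1 [us1 H1]] := abs_sum_approx f sf _ e1.
have e2 : 0 < e / 2 by rewrite divr_gt0.
have [s2 [us2 H2]] := abs_sum_approx g sg _ e2.
apply: (abs_sum_near _ (undup (s1 ++ s2))) => //; first exact: undup_uniq.
move=> s us sub.
have {}H1 : `|\sum_(x <- s) f x - abs_sum f| <= e / (2 * (1 + `|a|)).
  by apply: H1 => // x xs; apply: sub; rewrite mem_undup mem_cat xs.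
have {}H2 : `|\sum_(x <- s) g x - abs_sum g| <= e / 2.
  by apply: H2 => // x xs; apply: sub; rewrite mem_undup mem_cat xs orbT.
rewrite big_split /= -mulr_sumr.
rewrite (_ : _ - _ = a * (\sum_(x <- s) f x - abs_sum f) +
  (\sum_(x <- s) g x - abs_sum g)); last by ring.
apply: le_trans (ler_normD _ _) _; rewrite normrM.
have : `|a| * `|\sum_(x <- s) f x - abs_sum f| <= e / 2.
  apply: le_trans (ler_wpM2l (normr_ge0 a) H1) _.
  rewrite mulrA ler_pdivrMr// mulrC; have := normr_ge0 a; nra.
lra.
Qed.

End FiniteSums.

(** * Selection of humps *)

Lemma near_finite_set {I T : Type} (F : set_system T) {FF : Filter F}
    (D : set I) (P : I -> T -> Prop) : finite_set D ->
  (forall i, D i -> \forall x \near F, P i x) ->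
  \forall x \near F, forall i, D i -> P i x.
Proof.
elim/Pchoice: I => I in D P *.
move=> /finite_fsetP[X ->] H.
have := @filter_bigI _ _ X P F FF H.
by apply: filterS => x Px i Xi; exact: Px.
Qed.

(** The admissibility of the next element may depend on the whole finite history
    of the elements chosen before it. *)
Lemma dependent_choice {T : Type} (P : seq T -> T -> Prop) :
  (forall h, exists p, P h p) ->
  exists f : nat -> T, forall m, P (mkseq f m) (f m).
Proof.
move=> /boolp.choice[c Pc].
pose hist := fix hist n := if n is m.+1 then rcons (hist m) (c (hist m)) else [::].
exists (fun m => c (hist m)) => m.
suff -> : mkseq (fun m => c (hist m)) m = hist m by [].
by elim: m => [//|m IH]; rewrite mkseqS IH.
Qed.

Section GlidingHump.
Context {R : realType} {V : choiceType}.
Variable GG : set (set V).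
Hypothesis GG_locfin : forall x, finite_set [set A | GG A /\ A x].
Hypothesis GG_cover : \bigcup_(A in GG) A = [set: V].

Definition all_sum_le (v : V -> R) (C : R) : Prop :=
  forall A, GG A -> sum_le A v C.

Definition null_sums (w : nat -> V -> R) : Prop :=
  forall A, GG A -> forall e : R, 0 < e -> \forall n \near \oo, sum_le A (w n) e.

Definition in_kdual (z : V -> R) : Prop :=
  forall v C, all_sum_le v C -> abs_summable (fun x => v x * z x).

Variables (w : nat -> V -> R) (C : R).
Hypothesis C0 : 0 <= C.
Hypothesis w_bounded : forall n, all_sum_le (w n) C.
Hypothesis w_null : null_sums w.

(** Local finiteness of the family enters here: a finite set of vertices meets
    only finitely many members A, so the sums over all of them become small
    simultaneously. *)
Lemma near_meeting (H : seq V) (e : R) : 0 < e ->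
  \forall n \near \oo, forall A, GG A /\ (exists2 x, x \in H & A x) ->
    sum_le A (w n) e.
Proof.
move=> e0; apply: (near_finite_set _ [set A | GG A /\ _]).
  apply: (@sub_finite_set _ _ (\bigcup_(x in [set` H]) [set A | GG A /\ A x])).
    by move=> A [GA [x xH Ax]]; exists x.
  by apply: bigcup_finite => //; exact: finite_seq.
by move=> A [GA _]; exact: w_null.
Qed.

Lemma near_pointwise x (e : R) : 0 < e -> \forall n \near \oo, `|w n x| <= e.
Proof.
move=> e0; have [A GA Ax] : (\bigcup_(A in GG) A) x by rewrite GG_cover.
by apply: filterS (w_null A GA e e0) => n /sum_le_pt; exact.
Qed.

Lemma near_weighted_sum (H : seq V) (c : V -> R) (e : R) : 0 < e ->
  \forall n \near \oo, \sum_(x <- H) `|w n x| * c x <= e.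
Proof.
elim: H e => [|x H IH] e e0; first by near=> n; rewrite big_nil ltW.
have e2 : 0 < e / 2 by rewrite divr_gt0.
have c1 : 0 < 1 + `|c x| by rewrite ltr_pwDl.
near=> n; rewrite big_cons.
have : \sum_(y <- H) `|w n y| * c y <= e / 2 by near: n; exact: IH.
suff : `|w n x| * c x <= e / 2 by lra.
have : `|w n x| <= e / 2 / (1 + `|c x|).
  by near: n; apply: near_pointwise; rewrite divr_gt0.
rewrite ler_pdivlMr//; have := normr_ge0 (w n x); have := ler_norm (c x); nra.
Unshelve. all: by end_near. Qed.

(** A hump is a pair (n, t): the restriction of w n to the finite set t. A history
    is the sequence of the humps chosen so far. *)
Definition hist_supp (h : seq (nat * seq V)) : seq V := flatten (map snd h).

Lemma mem_hist_supp (f : nat -> nat * seq V) m x :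
  reflect (exists2 i, (i < m)%N & x \in (f i).2) (x \in hist_supp (mkseq f m)).
Proof.
apply: (iffP flattenP) => [[_ /mapP[p /mapP[i + ->] ->] xi]|[i im xi]].
  by rewrite mem_iota => /andP[_ im]; exists i.
exists (f i).2 => //; apply/mapP; exists (f i) => //; apply/mapP; exists i => //.
by rewrite mem_iota.
Qed.

(** Finitely many of the sets t m cover any finite part of D where g is nonzero, so
    the sum over D is bounded by the total of the sums over the pieces D `&` t m. *)
Lemma sum_le_humps (t : nat -> seq V) (D : set V) (g : V -> R) (c : nat -> R) B :
  (forall x, (forall m, x \notin t m) -> g x = 0) ->
  (forall m, sum_le (D `&` [set` t m]) g (c m)) ->
  (forall M, \sum_(m < M) c m <= B) ->
  sum_le D g B.
Proof.
move=> g0 gc cB s us sD.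
have /boolp.choice[idx Hidx] : forall x, exists i,
    (exists m, x \in t m) -> x \in t i.
  move=> x; case: (pselect (exists m, x \in t m)) => [[m xm]|n].
    by exists m.
  by exists 0%N.
pose M := (\max_(x <- s) idx x).+1; apply: le_trans (cB M).
apply: (@le_trans _ _ (\sum_(m < M) \sum_(x <- s | x \in t m) `|g x|)); last first.
  apply: ler_sum => m _; rewrite -big_filter; apply: gc.
    by rewrite filter_uniq.
  by move=> x; rewrite mem_filter => /andP[xm /sD].
under [leRHS]eq_bigr do rewrite big_mkcond.
rewrite exchange_big /=; rewrite big_seq [leRHS]big_seq; apply: ler_sum => x xs.
case: (pselect (exists m, x \in t m)) => [/Hidx xi|nx]; last first.
  rewrite g0 ?normr0 ?sumr_ge0// => [i _|m]; first by case: ifP.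
  by apply/negP => xm; apply: nx; exists m.
have iM : (idx x < M)%N by rewrite ltnS; exact: leq_bigmax_seq.
rewrite (bigD1 (Ordinal iM)) //= xi lerDl sumr_ge0// => i _.
by case: ifP.
Qed.

(** The first hump that meets A contributes at most C to the sum over A; a
    later one, with index m, contributes at most 2^-(m+1), because the history
    already meets A. *)
Lemma hump_sum_le (A : set V) (f : nat -> nat * seq V) (v : V -> R) :
  GG A ->
  (forall m x, x \in (f m).2 -> v x = w (f m).1 x) ->
  (forall x, (forall m, x \notin (f m).2) -> v x = 0) ->
  (forall m, (exists2 x, x \in hist_supp (mkseq f m) & A x) ->
     sum_le A (w (f m).1) (2^-1 ^+ m.+1)) ->
  sum_le A v (C + 1).
Proof.
move=> GA vw v0 small.
pose met m := exists2 x, x \in hist_supp (mkseq f m) & A x.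
pose meets m := exists2 x, x \in (f m).2 & A x.
pose c m := if pselect (met m) then 2^-1 ^+ m.+1
            else if pselect (meets m) then C else 0.
apply: (sum_le_humps (fun m => (f m).2) A v c) => //.
  move=> m; apply: (@sum_le_dom _ _ _ _ (w (f m).1)).
    by move=> x [_ /= /vw ->].
  move=> s us sA; rewrite /c; case: pselect => [ym|ny] /=.
    by apply: (small m ym) => // x /sA[].
  case: pselect => [y|nm] /=; first by apply: (w_bounded _ A GA) => // x /sA[].
  by rewrite big1_seq// => x /= /sA[Ax xm]; case: nm; exists x.
move=> M; suff [[_ ->]|[_]] : (~ met M /\ \sum_(m < M) c m = 0) \/
    (met M /\ \sum_(m < M) c m <= C + 1 - 2^-1 ^+ M).
- by rewrite addr_ge0.
- by move/le_trans; apply; rewrite gerBl exprn_ge0// invr_ge0.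
elim: M => [|M IH].
  by left; rewrite big_ord0; split=> // -[x]; rewrite /hist_supp.
have metS : met M.+1 <-> met M \/ meets M.
  rewrite /met /meets /hist_supp mkseqS map_rcons flatten_rcons.
  split=> [[x]|[[x xh Ax]|[x xh Ax]]].
  - by rewrite mem_cat => /orP[xh|xM] Ax; [left|right]; exists x.
  - by exists x => //; rewrite mem_cat xh.
  - by exists x => //; rewrite mem_cat xh orbT.
rewrite big_ord_recr /= /c.
have p0 : 0 < 2^-1 ^+ M :> R by rewrite exprn_gt0// invr_gt0.
case: IH => [[nmet ->]|[yes le]]; last first.
  right; split; first by apply/metS; left.
  by case: pselect => //= y; move: le; rewrite exprS; lra.
case: pselect => //= n; case: pselect => [yM|nM] /=.
  right; split; first by apply/metS; right.
  have : 2^-1 ^+ M <= 1 :> R by rewrite exprn_ile1// ?invr_ge0// invf_le1// ler1n.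
  by rewrite exprS; lra.
by left; rewrite addr0; split=> // /metS[].
Qed.

(** If humps with an additional property Q, off the support of the history and
    with arbitrarily large index, always exist, then some sequence of disjoint
    humps can be superposed into a single function v whose sums over all the
    members of the family stay bounded. The constraint imposed on a new hump
    besides Q is that it is small on the members that the history meets. *)
Lemma gliding_hump (Q : seq (nat * seq V) -> nat * seq V -> Prop) :
  (forall h N, exists p, [/\ (N <= p.1)%N, uniq p.2,
     forall x, x \in p.2 -> x \notin hist_supp h & Q h p]) ->
  exists (f : nat -> nat * seq V) (v : V -> R),
    [/\ all_sum_le v (C + 1),
        forall m, Q (mkseq f m) (f m),
        forall m, uniq (f m).2,
        forall i j x, x \in (f i).2 -> x \in (f j).2 -> i = j &
        forall m x, x \in (f m).2 -> v x = w (f m).1 x] /\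
    (forall x, (forall m, x \notin (f m).2) -> v x = 0).
Proof.
move=> HQ.
have [|f Pf] := dependent_choice (fun h p => [/\ uniq p.2,
    forall x, x \in p.2 -> x \notin hist_supp h,
    forall A, GG A /\ (exists2 x, x \in hist_supp h & A x) ->
      sum_le A (w p.1) (2^-1 ^+ (size h).+1) & Q h p]).
  move=> h; have e0 : 0 < 2^-1 ^+ (size h).+1 :> R.
    by rewrite exprn_gt0// invr_gt0.
  have [N _ HN] := near_meeting (hist_supp h) _ e0.
  by have [p [Np up dp Qp]] := HQ h N; exists p; split => //; exact: HN.
have disj i j x : x \in (f i).2 -> x \in (f j).2 -> i = j.
  wlog ij : i j / (i < j)%N.
    move=> H xi xj; case: (ltngtP i j) => // ij; first exact: H ij xi xj.
    by apply/esym; exact: H ij xj xi.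
  move=> xi xj; have [_ /(_ x xj) + _ _] := Pf j.
  by move/mem_hist_supp; case; exists i.
have /boolp.choice[idx Hidx] : forall x, exists i,
    (exists m, x \in (f m).2) -> x \in (f i).2.
  move=> x; case: (pselect (exists m, x \in (f m).2)) => [[m xm]|n].
    by exists m.
  by exists 0%N.
pose v x := if x \in (f (idx x)).2 then w (f (idx x)).1 x else 0.
have vw m x : x \in (f m).2 -> v x = w (f m).1 x.
  move=> xm; have xi := Hidx x (ex_intro _ m xm).
  by rewrite /v xi (disj _ _ _ xi xm).
have v0 x : (forall m, x \notin (f m).2) -> v x = 0.
  by move=> nx; rewrite /v (negbTE (nx _)).
exists f, v; split=> //; split=> // [A GA|m|m]; last 2 first.
- by have [] := Pf m.
- by have [] := Pf m.
apply: (hump_sum_le A f v) => // m Hm; have [_ _ H _] := Pf m.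
by have := H A (conj GA Hm); rewrite size_mkseq.
Qed.

(** Otherwise there are disjoint humps of w on which the sum of |w n z| is at least
    e / 2; their superposition v belongs to the space, and the sum of |v z|
    diverges. *)
Lemma kdual_null (z : V -> R) : in_kdual z -> forall e : R, 0 < e ->
  \forall n \near \oo, sum_le setT (fun x => w n x * z x) e.
Proof.
move=> zdual e e0; apply: contrapT => nnear.
have often N : exists n s, [/\ (N <= n)%N, uniq s &
    e < \sum_(x <- s) `|w n x * z x|].
  apply: contrapT => H; apply: nnear; exists N => // n /= Nn s us _.
  by rewrite leNgt; apply/negP => es; apply: H; exists n, s.
have e2 : 0 < e / 2 by rewrite divr_gt0.
have [|f [v [[vC Qf uf disj vw] _]]] := gliding_hump (fun _ p =>
    e / 2 <= \sum_(x <- p.2) `|w p.1 x * z x|).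
  move=> h N; have [N1 _ HN1] :=
    near_weighted_sum (undup (hist_supp h)) (fun x => `|z x|) _ e2.
  have [n [s [Nn us es]]] := often (maxn N N1).
  exists (n, [seq x <- s | x \notin hist_supp h]); split => /=.
  - by apply: leq_trans Nn; exact: leq_maxl.
  - by rewrite filter_uniq.
  - by move=> x; rewrite mem_filter => /andP[].
  - move: es; rewrite (big_filterID _ s (hist_supp h)).
    suff : \sum_(x <- [seq x <- s | x \in hist_supp h]) `|w n x * z x| <= e / 2 by lra.
    have /HN1 /= : (N1 <= n)%N by apply: leq_trans Nn; exact: leq_maxr.
    apply: le_trans.
    under eq_bigr do rewrite normrM.
    apply: (ler_sum_subset (fun x => `|w n x| * `|z x|)); rewrite ?filter_uniq ?undup_uniq//.
    by move=> x; rewrite mem_filter mem_undup => /andP[].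
have [c Hc] := zdual v _ vC.
have lb M : exists s, [/\ uniq s, {subset s <= hist_supp (mkseq f M)} &
    M%:R * (e / 2) <= \sum_(x <- s) `|v x * z x|].
  elim: M => [|M [s [us ss le]]].
    by exists [::]; split => //; rewrite mul0r big_nil.
  exists (s ++ (f M).2); split.
  - rewrite cat_uniq us uf andbT/=; apply/hasPn => x xM; apply/negP => /ss.
    by case/mem_hist_supp => i iM xi; move: iM; rewrite (disj _ _ _ xi xM) ltnn.
  - move=> x; rewrite mem_cat => /orP[/ss/mem_hist_supp H|xM]; apply/mem_hist_supp.
      by case: H => i iM xi; exists i => //; exact: ltnW.
    by exists M.
  - rewrite big_cat /= -natr1 mulrDl mul1r lerD//; apply: le_trans (Qf M) _.
    rewrite big_seq [leRHS]big_seq; apply: ler_sum => x xM.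
    by rewrite (vw M).
(* M * (e / 2) exceeds the bound c as soon as M > c / (e / 2). *)
have [s [us _ le]] := lb (Num.trunc (c / (e / 2))).+1.
have := Hc s us (fun _ _ => I).
have := Num.Theory.truncnS_gt (c / (e / 2)).
rewrite ltr_pdivrMr// => lt le'.
by have := lt_le_trans (lt_le_trans lt le) le'; rewrite ltxx.
Qed.

End GlidingHump.

(** * Null sequences on sets with weak cluster points *)

Section Uniform.
Context {R : realType} {V : choiceType}.
Variable GG : set (set V).
Hypothesis GG_locfin : forall x, finite_set [set A | GG A /\ A x].
Hypothesis GG_cover : \bigcup_(A in GG) A = [set: V].
Implicit Types (v z : V -> R).

Definition delta (x y : V) : R := (y == x)%:R.

Lemma all_sum_le_delta x : all_sum_le GG (delta x) 1.
Proof.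
move=> A _ s us _.
have -> : \sum_(y <- s) `|delta x y| = \sum_(y <- s | y == x) 1.
  rewrite [RHS]big_mkcond; apply: eq_bigr => y _.
  by rewrite /delta; case: eqP => _; rewrite ?normr1 ?normr0.
case: (boolP (x \in s)) => xs; first by rewrite -big_filter filter_pred1_uniq ?big_seq1.
by rewrite big1_seq// => y /andP[/eqP ->]; rewrite (negbTE xs).
Qed.

Lemma pairing_delta x z : pairing (delta x) z = z x.
Proof.
rewrite /pairing (abs_sum_finite _ [:: x])// ?big_seq1 /delta ?eqxx ?mul1r//.
by move=> y; rewrite inE => /negbTE ->; rewrite mul0r.
Qed.

Lemma in_kdualB z z' : in_kdual GG z -> in_kdual GG z' ->
  in_kdual GG (fun x => z x - z' x).
Proof.
move=> dz dz' v C vC; have [c Hc] := dz v C vC; have [d Hd] := dz' v C vC.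
exists (c + `|-1| * d); apply: sum_le_dom (sum_leD _ _ _ _ _ Hc (sum_leZ _ _ _ (-1) Hd)).
by move=> x _; rewrite mulrBr mulN1r.
Qed.

Lemma pairingB v C z z' : all_sum_le GG v C ->
  in_kdual GG z -> in_kdual GG z' ->
  pairing v (fun x => z x - z' x) = pairing v z - pairing v z'.
Proof.
move=> vC dz dz'; rewrite /pairing.
have := abs_sum_linear _ _ (-1) (dz' v C vC) (dz v C vC).
rewrite mulN1r addrC => <-; congr abs_sum; apply/funext => x; ring.
Qed.

(** y0 is a cluster point of the sequence y for the weak topology. *)
Definition weak_cluster (y : nat -> V -> R) (y0 : V -> R) : Prop :=
  forall D : set (V -> R), finite_set D ->
    (forall v, D v -> exists C, all_sum_le GG v C) ->
  forall e : R, 0 < e -> forall N, exists2 n, (N <= n)%N &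
    forall v, D v -> `|pairing v (y n) - pairing v y0| < e.

Definition seq_clusters (K : set (V -> R)) : Prop :=
  forall y : nat -> V -> R, (forall n, K (y n)) ->
  exists2 y0, in_kdual GG y0 & weak_cluster y y0.

Lemma near_expr_half (e : R) : 0 < e -> \forall n \near \oo, 2^-1 ^+ n <= e.
Proof.
move=> e0; have h1 : `|2^-1 : R| < 1.
  by rewrite ger0_norm ?invr_ge0// invf_lt1// ltr1n.
have /cvgr0_norm_le/(_ _ e0) := cvg_expr h1.
by apply: filterS => n; apply: le_trans; exact: ler_norm.
Qed.

Lemma sum_half_le (M : nat) (c : R) : 0 <= c ->
  \sum_(i < M) c * 2^-1 ^+ i.+1 <= c.
Proof.
move=> c0; rewrite -mulr_sumr -[leRHS]mulr1 ler_wpM2l//.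
suff -> : \sum_(i < M) 2^-1 ^+ i.+1 = 1 - 2^-1 ^+ M :> R.
  by rewrite gerBl exprn_ge0// invr_ge0.
elim: M => [|M IH]; first by rewrite big_ord0 expr0 subrr.
by rewrite big_ord_recr/= IH exprS; field.
Qed.

(** The hump p carries a fixed part of the pairing of w with y - y0, while its
    interactions with the humps q of the history, in both directions, are
    negligible. The last clause makes y converge to y0 on the support of all the
    humps. *)
Definition good_hump (w y : nat -> V -> R) (y0 : V -> R) (eps : R)
    (h : seq (nat * seq V)) (p : nat * seq V) : Prop :=
  let small := eps / 8 * 2^-1 ^+ (size h).+1 in
  [/\ eps / 8 * 3 <= `|\sum_(x <- p.2) w p.1 x * (y p.1 x - y0 x)|,
      forall q, q \in h ->
        \sum_(x <- q.2) `|w q.1 x * (y p.1 x - y0 x)| <= small,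
      forall q, q \in h ->
        sum_le setT (fun x => w p.1 x * (y q.1 x - y0 x)) small &
      forall x, x \in hist_supp h -> `|y p.1 x - y0 x| <= small].

(** Since y0 is a cluster point, y n is close to y0 on the finite support of the
    history for arbitrarily large n. For such n the pairing of w n with y n,
    which is at least eps, loses at most eps / 2 by truncation to a finite set s,
    eps / 16 by the passage from y n to y n - y0, and eps / 16 by the removal
    of the support of the history from s. *)
Lemma good_hump_exists (w y : nat -> V -> R) (C eps : R) (y0 : V -> R) :
  0 <= C -> 0 < eps ->
  (forall n, all_sum_le GG (w n) C) -> null_sums GG w ->
  (forall n, in_kdual GG (y n)) -> in_kdual GG y0 -> weak_cluster y y0 ->
  (forall n, eps <= `|pairing (w n) (y n)|) ->
  forall (h : seq (nat * seq V)) N, exists p : nat * seq V,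
   [/\ (N <= p.1)%N, uniq p.2,
     forall x, x \in p.2 -> x \notin hist_supp h & good_hump w y y0 eps h p].
Proof.
move=> C0 eps0 wC wnull ydual y0dual ycl wy h N.
pose del : R := eps / 8 * 2^-1 ^+ (size h).+1.
have del0 : 0 < del by rewrite mulr_gt0 ?divr_gt0// exprn_gt0// invr_gt0.
have del_le : del <= eps / 8.
  rewrite /del -[leRHS]mulr1 ler_wpM2l ?divr_ge0 ?(ltW eps0)//.
  by apply: exprn_ile1; rewrite ?invr_ge0// invf_le1// ler1n.
have null z (e : R) : in_kdual GG z -> 0 < e ->
    \forall n \near \oo, sum_le setT (fun x => w n x * z x) e.
  by move=> dz; apply: (kdual_null GG GG_locfin GG_cover w C).
have half0 : 0 < 2^-1 :> R by rewrite invr_gt0.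
have eps16 : 0 < eps / 16 by rewrite divr_gt0.
have [N1 _ H1] : \forall n \near \oo, forall q, [set` h] q ->
    sum_le setT (fun x => w n x * (y q.1 x - y0 x)) del.
  apply: near_finite_set => [|q _]; first exact: finite_seq.
  by apply: null => //; exact: in_kdualB.
have [N2 _ H2] := null y0 _ y0dual eps16.
have [N3 _ H3] := near_weighted_sum GG GG_cover w wnull
  (undup (hist_supp h)) (fun _ => 1) _ half0.
(* Closeness d of y n to y0 on the history makes all its interactions small. *)
pose L := \sum_(q <- h) \sum_(x <- q.2) `|w q.1 x|.
have L0 : 0 <= L by apply: sumr_ge0 => q _; exact: sumr_ge0.
pose d := del / (1 + L).
have L1 : 0 < 1 + L by rewrite ltr_pwDl.
have d0 : 0 < d by rewrite divr_gt0.
have [//||n Nn Hn] := ycl (delta @` [set` hist_supp h]) _ _ d d0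
    (maxn N (maxn N1 (maxn N2 N3))).
- by apply: finite_image; exact: finite_seq.
- by move=> _ [x _ <-]; exists 1; exact: all_sum_le_delta.
have {}Hn x : x \in hist_supp h -> `|y n x - y0 x| <= d.
  by move=> xh; have := Hn _ (imageP delta xh); rewrite !pairing_delta => /ltW.
move: Nn; rewrite !geq_max => /and4P[N0n /H1{}H1 /H2{}H2 /H3{}H3].
have d_del : d <= del.
  by rewrite /d ler_pdivrMr// ler_peMr ?(ltW del0)// lerDl.
(* s carries half of the pairing of w n with y n. *)
have [s [us Hs]] := abs_sum_approx _ (ydual n _ _ (wC n)) _ (divr_gt0 eps0 (ltr0Sn R 1)).
have {}Hs : eps / 2 <= `|\sum_(x <- s) w n x * y n x|.
  have := Hs s us (fun _ => id); have := wy n; rewrite /pairing.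
  set a := abs_sum _; set b := \sum_(x <- s) _.
  have : `|a| <= `|b - a| + `|b|.
    by rewrite addrC -{1}(subKr b a) (le_trans (ler_normB _ _)).
  lra.
have Hs0 : `|\sum_(x <- s) w n x * y0 x| <= eps / 16.
  by apply: le_trans (ler_norm_sum _ _ _) _; exact: H2.
have Hsh : `|\sum_(x <- [seq x <- s | x \in hist_supp h]) w n x * (y n x - y0 x)|
    <= eps / 16.
  apply: le_trans (ler_norm_sum _ _ _) _.
  apply: (@le_trans _ _ (\sum_(x <- undup (hist_supp h)) `|w n x| * (eps / 8))).
    apply: (@le_trans _ _ (\sum_(x <- [seq x <- s | x \in hist_supp h])
        `|w n x| * (eps / 8))).
      rewrite big_seq [leRHS]big_seq; apply: ler_sum => x.
      rewrite mem_filter => /andP[/Hn xd _]; rewrite normrM ler_wpM2l//.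
      exact: le_trans xd (le_trans d_del del_le).
    apply: (ler_sum_subset (fun x => `|w n x| * (eps / 8))).
    - by move=> x; rewrite mulr_ge0// ltW// divr_gt0.
    - by rewrite filter_uniq.
    - exact: undup_uniq.
    - by move=> x; rewrite mem_filter mem_undup => /andP[].
  rewrite -mulr_suml; move: H3 => /=; under eq_bigr do rewrite mulr1.
  move=> H3; have : 0 < eps / 8 by rewrite divr_gt0.
  nra.
exists (n, [seq x <- s | x \notin hist_supp h]); split => //=.
- by rewrite filter_uniq.
- by move=> x; rewrite mem_filter => /andP[].
split.
- have := big_filterID (fun x => w n x * (y n x - y0 x)) s (hist_supp h).
  have -> : \sum_(x <- s) w n x * (y n x - y0 x) =
      \sum_(x <- s) w n x * y n x - \sum_(x <- s) w n x * y0 x.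
    by rewrite -sumrB; apply: eq_bigr => x _; rewrite mulrBr.
  move: Hs Hs0 Hsh.
  set a := \sum_(x <- s) _; set b := \sum_(x <- s) _.
  set c := \sum_(x <- _) _; set e := \sum_(x <- _) _ => Ha Hb Hc E.
  have -> : e = a - b - c by rewrite E; ring.
  have := ler_normD (a - b - c) (b + c).
  rewrite (_ : a - b - c + (b + c) = a); last by ring.
  have := ler_normD b c; lra.
- move=> q qh; apply: (@le_trans _ _ (\sum_(x <- q.2) `|w q.1 x| * d)).
    rewrite big_seq [leRHS]big_seq; apply: ler_sum => x xq.
    rewrite normrM ler_wpM2l// Hn//; apply/flattenP; exists q.2 => //.
    by apply/mapP; exists q.
  rewrite -mulr_suml; apply: (@le_trans _ _ (L * d)).
    rewrite ler_wpM2r ?(ltW d0)//.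
    rewrite /L (big_rem q)//= lerDl; apply: sumr_ge0 => ? _; exact: sumr_ge0.
  by rewrite /d mulrA ler_pdivrMr// mulrC ler_wpM2l ?ltW// ltrDr.
- by move=> q qh; exact: H1.
- by move=> x /Hn/le_trans; apply.
Qed.

(** A null sequence w of bounded sums converges to 0 uniformly on K. If the
    pairings of w n with y n in K stayed above eps, then for v the superposition
    of good humps, the pairing of v with y at the m-th hump would differ from its
    pairing with y0 by at least 3 eps / 8 - eps / 8 > 0 for all m. A cluster
    point y1 of the y along the humps agrees with y0 on the support of v,
    which contradicts this. *)
Lemma uniformly_null (K : set (V -> R)) (w y : nat -> V -> R) (C eps : R) :
  K `<=` in_kdual GG -> seq_clusters K ->
  0 <= C -> (forall n, all_sum_le GG (w n) C) -> null_sums GG w ->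
  (forall n, K (y n)) -> 0 < eps ->
  exists n, `|pairing (w n) (y n)| < eps.
Proof.
move=> Kdual Kcl C0 wC wnull Ky eps0; apply: contrapT => nsmall.
have wy n : eps <= `|pairing (w n) (y n)|.
  by rewrite leNgt; apply/negP => H; apply: nsmall; exists n.
have ydual n : in_kdual GG (y n) by exact: Kdual.
have [y0 y0dual y0cl] := Kcl y Ky.
have step := good_hump_exists w y C eps y0 C0 eps0 wC wnull ydual y0dual y0cl wy.
have [f [v [[vC Qf uf disj vw] v0]]] :=
  gliding_hump GG GG_locfin w C C0 wC wnull _ step.
have eps8 : 0 < eps / 8 by rewrite divr_gt0.
pose Y m := y (f m).1.
have [|y1 y1dual y1cl] := Kcl Y; first by move=> n; exact: Ky.
have y10 m x : x \in (f m).2 -> y1 x = y0 x.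
  move=> xm; apply/eqP; rewrite -subr_eq0 -normr_le0.
  apply/ler_addgt0Pr => e e0; rewrite add0r.
  have e2 : 0 < e / 2 by rewrite divr_gt0.
  have [N _ HN] := near_expr_half _ (divr_gt0 e2 eps8).
  have [||n Nn Hn] := y1cl [set delta x] _ _ _ e2 (maxn N m.+1).
  - exact: finite_set1.
  - by move=> _ ->; exists 1; exact: all_sum_le_delta.
  have := Hn _ erefl; rewrite !pairing_delta => Hn1.
  have [_ _ _ /(_ x)] := Qf n; rewrite size_mkseq => Hn0.
  have {}Hn0 : `|Y n x - y0 x| <= e / 2.
    apply: le_trans (Hn0 _) _.
      by apply/mem_hist_supp; exists m => //; apply: leq_trans Nn; exact: leq_maxr.
    rewrite mulrC -ler_pdivlMr//; apply: HN => /=.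
    by rewrite leqW// (leq_trans _ Nn)// leq_maxl.
  have := ler_distD (Y n x) (y1 x) (y0 x); rewrite (distrC (y1 x) (Y n x)); lra.
have far m : eps / 8 <= `|pairing v (Y m) - pairing v y0|.
  rewrite -(pairingB v (C + 1) (Y m) y0 vC (ydual _) y0dual); set q := fun x => Y m x - y0 x.
  have qdual : in_kdual GG q by exact: (in_kdualB _ _ (ydual _) y0dual).
  have [Q1 _ _ _] := Qf m.
  (* Contribution to the pairing of all the humps other than the m-th. *)
  pose rest x := if x \in (f m).2 then 0 else v x * q x.
  have restle : sum_le setT rest (eps / 8).
    apply: (sum_le_humps (fun i => (f i).2) _ _ (fun i => eps / 8 * 2^-1 ^+ i.+1)).
    - by move=> x /v0 vx; rewrite /rest vx mul0r if_same.
    - move=> i s us sf; case: (ltngtP i m) => [im|mi|eim].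
      + have [_ /(_ (f i)) Q2 _ _] := Qf m.
        apply: (@le_trans _ _ (eps / 8 * 2^-1 ^+ m.+1)); last first.
          rewrite ler_wpM2l ?(ltW eps8)// ler_wiXn2l ?invr_ge0// ?invf_le1 ?ler1n//.
          exact: ltnW.
        rewrite size_mkseq in Q2; apply: le_trans (Q2 _); last first.
          by apply/mapP; exists i => //; rewrite mem_iota.
        apply: (@le_trans _ _ (\sum_(x <- s) `|w (f i).1 x * q x|)).
          rewrite big_seq [leRHS]big_seq; apply: ler_sum => x /sf[_ xi].
          rewrite /rest; case: ifP => _; first by rewrite normr0.
          by rewrite (vw i).
        apply: ler_sum_subset => // x /sf[_]; exact.
      + have [_ _ /(_ (f m)) Q3 _] := Qf i.
        rewrite size_mkseq in Q3; apply: le_trans (Q3 _ s us _) => //.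
          rewrite big_seq [leRHS]big_seq; apply: ler_sum => x /sf[_ xi].
          rewrite /rest; case: ifP => _; first by rewrite normr0.
          by rewrite (vw i).
        by apply/mapP; exists m => //; rewrite mem_iota.
      + rewrite big1_seq; last first.
          by move=> x /= /sf[_ /=]; rewrite /rest eim => ->; rewrite normr0.
        by rewrite mulr_ge0 ?ltW// exprn_gt0// invr_gt0.
    - by move=> M; apply: sum_half_le; exact: ltW.
  have : `|pairing v q - \sum_(x <- (f m).2) v x * q x| <= eps / 8.
    apply: (abs_sum_near _ (f m).2) => //; first exact: qdual vC.
    move=> s us sub; rewrite (big_subseqID _ _ _ (uf m) us sub) addrC addKr.
    apply: le_trans (ler_norm_sum _ _ _) _.
    apply: le_trans (restle [seq x <- s | x \notin (f m).2] _ _) => //.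
      rewrite big_seq [leRHS]big_seq; apply: ler_sum => x.
      by rewrite mem_filter /rest => /andP[/negbTE ->].
    by rewrite filter_uniq.
  have -> : \sum_(x <- (f m).2) v x * q x =
      \sum_(x <- (f m).2) w (f m).1 x * (y (f m).1 x - y0 x).
    by apply: eq_big_seq => x /vw ->.
  move: Q1; set a := \sum_(x <- _) _; set b := pairing _ _ => Q1.
  have := ler_normB b (b - a); rewrite subKr; lra.
have eqv : pairing v y1 = pairing v y0.
  congr abs_sum; apply/funext => x.
  have [[k xk]|nx] := pselect (exists k, x \in (f k).2); first by rewrite (y10 k).
  by rewrite v0 ?mul0r// => k; apply/negP => xk; apply: nx; exists k.
have [||n _ Hn] := y1cl [set v] _ _ _ eps8 0%N.
- exact: finite_set1.
- by move=> _ ->; exists (C + 1).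
by have := Hn v erefl; rewrite eqv ltNge far.
Qed.

End Uniform.

(** * The dual pair and the compact unit balls *)

Section SeminormNbhs.
Context {R : realType} (E : lmodType R) (P : set (E -> R)).

Lemma opensE : opens P = seminorm_open P.
Proof. by []. Qed.

Lemma seminorm_nbhs (x : seminorm_top P) (U : set (seminorm_top P)) :
  nbhs x U -> exists F (e : R), [/\ finite_set F, F `<=` P, 0 < e &
    [set y : E | forall p, F p -> p (y - x) < e] `<=` U].
Proof.
rewrite nbhsE => -[W [oW Wx] WU].
by have [F [e [finF FP e0 FW]]] := oW x Wx; exists F, e; split => // y /FW /WU.
Qed.

Lemma nbhs_seminorm_ball (p : E -> R) (x : seminorm_top P) (e : R) :
  P p -> (forall y z, p (y + z) <= p y + p z) -> p 0 <= 0 -> 0 < e ->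
  nbhs x [set y : E | p (y - x) < e].
Proof.
move=> Pp pD p0 e0; rewrite nbhsE; exists [set y : E | p (y - x) < e] => //.
split; last by rewrite /= subrr (le_lt_trans p0).
move=> z /= zx; exists [set p], (e - p (z - x)); split => //.
- by move=> _ ->.
- by rewrite subr_gt0.
- move=> y /(_ p erefl) /= yz.
  have := pD (y - z) (z - x); rewrite addrA subrK => /le_lt_trans; apply.
  by rewrite -ltrBrDr.
Qed.

End SeminormNbhs.

Section SubspVal.
Context {R : realType} {V : choiceType} {S : submodClosed (V -> R)}.
Implicit Types y z : subsp S.

Lemma subspZ a z x : val (a *: z) x = a * val z x.
Proof. by rewrite linearZ. Qed.

Lemma subspD y z x : val (y + z) x = val y x + val z x.
Proof. by rewrite raddfD. Qed.

Lemma subspB y z x : val (y - z) x = val y x - val z x.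
Proof. by rewrite raddfB. Qed.

Lemma subsp0 x : val (0 : subsp S) x = 0.
Proof. by rewrite raddf0. Qed.

End SubspVal.

Section Duality.
Context {R : realType} {V : choiceType}.
Variable GG : set (set V).
Implicit Types (A : set V) (w : VS_space R GG) (z : VS_dual R GG).
Local Notation "<< w , z >>" := (VS_pairing R GG w z).

(** A multiple of a substochastic function has bounded sums; conversely |v| / C is
    substochastic when all the sums of |v| are at most C. *)
Lemma mem_VS (v : V -> R) : v \in VS GG <-> exists C, all_sum_le GG v C.
Proof.
split=> [/set_mem[_ [n [c [s [Ss ->]]]] vs]|[C vC]].
  exists (\sum_(i < n) `|c i|) => A GA t ut tA.
  apply: (@le_trans _ _ (\sum_(x <- t) \sum_(i < n) `|c i| * s i x)).
    apply: ler_sum => x _; apply: le_trans (vs x) _.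
    rewrite fct_sumE; apply: le_trans (ler_norm_sum _ _ _) _.
    by apply: ler_sum => i _; rewrite normrM (ger0_norm ((Ss i).1 x)).
  rewrite exchange_big; apply: ler_sum => i _; rewrite -mulr_sumr -[leRHS]mulr1.
  rewrite ler_wpM2l//.
  by have /esum_leP := (Ss i).2 A GA; apply.
(* The maximum with 1 allows division also when C = 0. *)
apply/mem_set; pose D := Num.max C 1.
have D0 : 0 < D by rewrite lt_max ltr01 orbT.
exists (D *: (fun x => `|v x| / D)); last first.
  by move=> x; rewrite [X in _ <= `|X|]mulrC divfK ?gt_eqF// normr_id.
exists 1%N, (fun=> D), (fun=> (fun x => `|v x| / D)); split; last first.
  by rewrite big_ord1.
move=> _; split=> [x|A GA]; first by rewrite divr_ge0// ltW.
apply/esum_leP => s us sA; rewrite -mulr_suml ler_pdivrMr// mul1r.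
by apply: le_trans (vC A GA s us sA) _; rewrite le_max lexx.
Qed.

Lemma mem_kdual (u : V -> R) : u \in kdual (@VS R V GG) <-> in_kdual GG u.
Proof.
split=> [/set_mem H v C vC|H].
  by apply/abs_summableP; apply: H; apply/mem_VS; exists C.
by apply/mem_set => v /mem_VS[C vC]; apply/abs_summableP; exact: H vC.
Qed.

Lemma VS_bound w : exists C, all_sum_le GG (val w) C.
Proof. by apply/mem_VS; exact: valP. Qed.

Lemma VS_dualP z : in_kdual GG (val z).
Proof. by apply/mem_kdual; exact: valP. Qed.

Lemma VS_pairingDr w z z' : <<w, z + z'>> = <<w, z>> + <<w, z'>>.
Proof.
have [C wC] := VS_bound w.
have := abs_sum_linear _ _ 1 (VS_dualP z _ _ wC) (VS_dualP z' _ _ wC).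
rewrite mul1r => <-; congr abs_sum; apply/funext => x.
by rewrite subspD mul1r mulrDr.
Qed.

Lemma VS_pairingZr w z a : <<w, a *: z>> = a * <<w, z>>.
Proof.
have [C wC] := VS_bound w.
have s0 : abs_summable (fun _ : V => 0 : R).
  by exists 0 => s us _; rewrite big1// => i _; rewrite normr0.
have := abs_sum_linear _ _ a (VS_dualP z _ _ wC) s0.
rewrite [X in _ = _ + X](abs_sum_finite _ [::])// big_nil addr0 => <-.
congr abs_sum; apply/funext => x; rewrite addr0.
by rewrite subspZ mulrCA.
Qed.

Lemma VS_pairing0r w : <<w, 0>> = 0.
Proof. by rewrite -(scale0r 0) VS_pairingZr mul0r. Qed.

Lemma VS_pairingDl w w' z : <<w + w', z>> = <<w, z>> + <<w', z>>.
Proof.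
have [C wC] := VS_bound w; have [C' wC'] := VS_bound w'.
have := abs_sum_linear _ _ 1 (VS_dualP z _ _ wC) (VS_dualP z _ _ wC').
rewrite mul1r => <-; congr abs_sum; apply/funext => x.
by rewrite subspD mul1r mulrDl.
Qed.

Lemma VS_pairing0l z : <<0, z>> = 0.
Proof. by apply: (addIr <<0, z>>); rewrite -VS_pairingDl !add0r. Qed.

Lemma pkE A w : GG A -> (pk A w)%:E = (\esum_(g in A) (`|val w g|)%:E)%E.
Proof.
move=> GA; rewrite /pk fineK//; have [C /(_ A GA)/sum_le_esum wC] := VS_bound w.
rewrite fin_numElt (le_lt_trans wC) ?ltry// andbT.
by apply: lt_le_trans (ltNyr 0) _; apply: esum_ge0 => x _; rewrite lee_fin.
Qed.

Lemma sum_le_pk A w c : GG A -> sum_le A (val w) c <-> pk A w <= c.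
Proof. by move=> GA; rewrite -lee_fin pkE//; exact: sum_le_esum. Qed.

Lemma pkD A w w' : GG A -> pk A (w + w') <= pk A w + pk A w'.
Proof.
move=> GA; apply/sum_le_pk => //.
apply: (@sum_le_dom _ _ _ _ (fun x => val w x + val w' x)).
  by move=> x _; rewrite subspD.
by apply: sum_leD; apply/sum_le_pk.
Qed.

Lemma pk0 A : GG A -> pk A (0 : VS_space R GG) <= 0.
Proof.
by move=> GA; apply/sum_le_pk => // s us _; rewrite big1// => i _; rewrite subsp0 normr0.
Qed.

(** The polar of the unit ball of [pk A]; it is the unit ball of the space of
    bounded functions on A, extended by 0. *)
Definition unit_ball A : set (VS_dual R GG) :=
  [set z | forall x, `|val z x| <= (x \in A)%:R].

Lemma sum_le_unit A (v u : V -> R) C : sum_le A v C ->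
  (forall x, `|u x| <= (x \in A)%:R) -> sum_le setT (fun x => v x * u x) C.
Proof.
move=> vC uA s us _; rewrite (bigID (mem A)) /= [X in _ + X]big1 ?addr0; last first.
  by move=> x /negbTE xA; have := uA x; rewrite xA normr_le0 => /eqP ->;
     rewrite mulr0 normr0.
rewrite -big_filter; apply: le_trans (vC [seq x <- s | x \in A] _ _).
- apply: ler_sum => x _; rewrite normrM ler_piMr//; apply: le_trans (uA x) _.
  by case: (x \in A).
- by rewrite filter_uniq.
- by move=> x; rewrite mem_filter => /andP[/set_mem].
Qed.

Lemma pairing_unit_ball A w z : GG A -> unit_ball A z -> `|<<w, z>>| <= pk A w.
Proof.
move=> GA zA; apply: abs_sum_le; apply: (sum_le_unit A) => //.
exact/sum_le_pk.
Qed.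

(** The sign of w on a finite part of A belongs to [unit_ball A] and pairs with w
    to the sum of |w| over that part. *)
Lemma polar_sum_le (K : set (VS_dual R GG)) A w : GG A -> unit_ball A `<=` K ->
  has_ubound [set `|<<w, z>>| | z in K] ->
  pk A w <= polar_seminorm (VS_pairing R GG) K w.
Proof.
move=> GA AK ub; apply/sum_le_pk => // s us sA.
pose u x := if x \in s then Num.sg (val w x) else 0.
have uA x : `|u x| <= (x \in A)%:R.
  rewrite /u; case: ifPn => [/sA Ax|_]; last by rewrite normr0.
  by rewrite mem_set// normr_sg; case: eqP.
have udual : u \in kdual (@VS R V GG).
  by apply/mem_kdual => v C vC; exists C; exact: (sum_le_unit _ _ _ _ (vC _ GA) uA).
have Ku : K (Subsp udual) by apply: AK => x; exact: uA.
apply: le_trans (ub_le_sup ub (imageP _ Ku)).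
suff -> : \sum_(x <- s) `|val w x| = <<w, Subsp udual>> by exact: ler_norm.
rewrite /VS_pairing /pairing (abs_sum_finite _ s) //=.
  apply: eq_big_seq => x xs; rewrite /u xs.
  by rewrite mulrC -normrEsg.
by move=> x /negbTE xs; rewrite /u xs mulr0.
Qed.

Lemma polar_unit_ball A : GG A ->
  polar_seminorm (VS_pairing R GG) (unit_ball A) = pk A.
Proof.
move=> GA; apply/funext => w; apply/eqP; rewrite eq_le; apply/andP; split.
  apply: ge_sup; last by move=> _ [z zA <-]; exact: pairing_unit_ball.
  by exists `|<<w, 0>>|, 0 => // x; rewrite subsp0 normr0.
apply: polar_sum_le => //; exists (pk A w) => _ [z zA <-].
exact: pairing_unit_ball.
Qed.

Lemma unit_ball_convex A : absolutely_convex (unit_ball A).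
Proof.
move=> y z a b yA zA ab x; rewrite subspD !subspZ.
apply: le_trans (ler_normD _ _) _; rewrite !normrM.
apply: (@le_trans _ _ ((`|a| + `|b|) * (x \in A)%:R)).
  by rewrite mulrDl lerD// ler_wpM2l.
by rewrite ler_piMl.
Qed.

(** An ultrafilter on the ball converges pointwise because closed intervals are
    compact. The pointwise limit is a weak limit: w is summable over A, so a
    finite set s0 carries all but a small part of the pairing with w, uniformly
    on the ball. *)
Lemma unit_ball_compact A : GG A ->
  compact (unit_ball A : set (seminorm_top (weak_seminorms (VS_pairing R GG)))).
Proof.
move=> GA; rewrite compact_ultra => F FU FA.
have FF : ProperFilter F by exact: ultra_proper.
have /boolp.choice[y Hy] : forall x : V, exists t : R, `|t| <= (x \in A)%:R /\
    forall e : R, 0 < e -> F [set z : VS_dual R GG | `|val z x - t| < e].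
  move=> x; pose ev (z : VS_dual R GG) := val z x; pose c : R := (x \in A)%:R.
  have FI : (ev @ F) `[- c, c]%classic.
    apply: (@filterS _ F _ (unit_ball A) _ _ FA) => z zA.
    by have := zA x; rewrite /= in_itv /= ler_norml.
  have [t [/= tc tcl]] := segment_compact _ FI.
  exists t; split; first by move: tc; rewrite in_itv /= ler_norml.
  move=> e e0.
  have [//|nF] := in_ultra_setVsetC [set z : VS_dual R GG | `|val z x - t| < e] FU.
  have [_ [/= [z zn <-]]] := tcl (ev @` ~` [set z : VS_dual R GG | `|val z x - t| < e]) (ball t e)
    (filterS (@preimage_image _ _ ev _) nF) (nbhsx_ballx t e e0).
  by rewrite /ball /= distrC => zt.
have ydual : y \in kdual (@VS R V GG).
  apply/mem_kdual => v C vC; exists C.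
  by apply: (sum_le_unit _ _ _ _ (vC _ GA)) => x; have [] := Hy x.
pose p : VS_dual R GG := Subsp ydual.
have pA : unit_ball A p by move=> x; have [] := Hy x.
exists p; split => // U /seminorm_nbhs[D [e [finD DP e0 DU]]].
apply: filterS DU _; apply: near_finite_set => // _ /DP[w _ <-].
have [C /(_ A GA) wC] := VS_bound w.
pose f x := val w x * (x \in A)%:R.
have sf : abs_summable f.
  by exists C; apply: sum_le_unit wC _ => x; rewrite normr_nat.
have e8 : 0 < e / 8 by rewrite divr_gt0.
have [s0 [us0 Hs0]] := abs_summable_tail f sf _ e8.
pose L := \sum_(x <- s0) `|val w x|.
have L1 : 0 < 1 + L by rewrite ltr_pwDl// sumr_ge0.
have d0 : 0 < e / 4 / (1 + L) by rewrite !divr_gt0.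
pose near_p (z : VS_dual R GG) := forall x, [set` s0] x ->
  `|val z x - y x| < e / 4 / (1 + L).
have Fp : F near_p.
  apply: near_finite_set => [|x _]; first exact: finite_seq.
  by have [_] := Hy x; apply.
apply: (@filterS _ F _ (unit_ball A `&` near_p) _ _ (filterI FA Fp)).
move=> z [zA zs].
apply: (@le_lt_trans _ _ (e / 2)); last by rewrite gtr_pMr// invf_lt1// ltr1n.
apply: abs_sum_le => s us _.
have vzE x : val (z - p) x = val z x - y x by rewrite subspB.
rewrite (big_filterID _ s s0) (_ : e / 2 = e / 4 + e / 4); last by field.
apply: lerD.
  apply: (@le_trans _ _ (\sum_(x <- s0) `|val w x| * (e / 4 / (1 + L)))).
    apply: (@le_trans _ _ (\sum_(x <- [seq x <- s | x \in s0])
       `|val w x| * (e / 4 / (1 + L)))).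
      rewrite big_seq [leRHS]big_seq; apply: ler_sum => x.
      rewrite mem_filter => /andP[xs0 _]; rewrite normrM ler_wpM2l// vzE ltW//.
      exact: zs.
    apply: (ler_sum_subset (fun x => `|val w x| * (e / 4 / (1 + L)))) => //.
    - by move=> x; rewrite mulr_ge0// ltW.
    - by rewrite filter_uniq.
    - by move=> x; rewrite mem_filter => /andP[].
  by rewrite -mulr_suml mulrCA ler_piMr ?divr_ge0 ?(ltW e0)// ler_pdivrMr// mul1r lerDr.
apply: (@le_trans _ _ (2 * \sum_(x <- [seq x <- s | x \notin s0]) `|f x|)).
  rewrite mulr_sumr; apply: ler_sum => x _; rewrite !normrM vzE normr_nat.
  rewrite mulrCA ler_wpM2l// mulr_natl mulr2n.
  apply: le_trans (ler_normB _ _) _; apply: lerD; first exact: zA.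
  by have [] := Hy x.
have := Hs0 [seq x <- s | x \notin s0]; rewrite filter_uniq// => /(_ isT).
move=> H; have {}H : \sum_(x <- [seq x <- s | x \notin s0]) `|f x| <= e / 8.
  by apply: H => x; rewrite mem_filter => /andP[].
lra.
Qed.

Lemma p_seminorms_mackey :
  p_seminorms R GG `<=` mackey_seminorms (VS_pairing R GG).
Proof.
move=> _ [A GA <-]; exists (unit_ball A); last exact: polar_unit_ball.
by split; [exact: unit_ball_convex | exact: unit_ball_compact].
Qed.

End Duality.

(** * Comparison of the topologies on strongly bounded sets *)

Section Strong.
Context {R : realType} {V : choiceType}.
Variable GG : set (set V).
Implicit Types (A : set V) (w : VS_space R GG) (z : VS_dual R GG).
Local Notation "<< w , z >>" := (VS_pairing R GG w z).

(** This set is weakly bounded, and its polar seminorm dominates every [pk A]; it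
    turns strong boundedness into a uniform bound on the sums. *)
Definition unit_balls : set (VS_dual R GG) := \bigcup_(A in GG) unit_ball GG A.

Lemma unit_balls_ubound w : has_ubound [set `|<<w, z>>| | z in unit_balls].
Proof.
have [C wC] := VS_bound GG w; exists C => _ [z [A GA zA] <-].
by apply: le_trans (pairing_unit_ball GG A w z GA zA) _; apply/sum_le_pk => //; exact: wC.
Qed.

Lemma unit_balls_bounded :
  bounded_for (weak_seminorms (VS_pairing R GG)) unit_balls.
Proof.
move=> U /seminorm_nbhs[D [e [finD DP e0 DU]]].
have bnd : \forall c \near +oo%R, forall p, D p -> forall z, unit_balls z -> p z <= c.
  apply: near_finite_set => // _ /DP[w _ <-].
  have [C HC] := unit_balls_ubound w.
  apply: filterS (nbhs_pinfty_ge (num_real C)) => c Cc z zK.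
  by apply: le_trans Cc; apply: HC; exists z.
have [c [c1 Hc]] := filter_ex (filterI (nbhs_pinfty_gt (num_real (1 : R))) bnd).
have c0 : 0 < c by apply: lt_trans c1.
exists (2 * c / e) => [|a ra z zK]; first by rewrite divr_gt0// mulr_gt0.
have a0 : 0 < `|a| by apply: lt_le_trans ra; rewrite divr_gt0// mulr_gt0.
have an0 : a != 0 by rewrite -normr_gt0.
exists (a^-1 *: z); last by rewrite scalerA divff// scale1r.
apply: DU => p Dp; have [w _ pw] := DP p Dp.
rewrite subr0 -pw VS_pairingZr normrM normfV ltr_pdivrMl//.
have := Hc p Dp z zK; rewrite -pw => /le_lt_trans; apply.
move: ra; rewrite ler_pdivrMr//; lra.
Qed.

Lemma polar_le (K : set (VS_dual R GG)) w (c : R) : 0 <= c ->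
  (forall z, K z -> `|<<w, z>>| <= c) ->
  polar_seminorm (VS_pairing R GG) K w <= c.
Proof.
move=> c0 Kc; have [-> | /set0P[z0 Kz0]] := eqVneq K set0.
  by rewrite /polar_seminorm image_set0 sup0.
by apply: ge_sup => [|_ [z zK <-]]; [exists `|<<w, z0>>|, z0 | exact: Kc].
Qed.

Lemma polar_unit_ballsD w w' :
  polar_seminorm (VS_pairing R GG) unit_balls (w + w') <=
  polar_seminorm (VS_pairing R GG) unit_balls w +
  polar_seminorm (VS_pairing R GG) unit_balls w'.
Proof.
have [e | /set0P[z0 z0K]] := eqVneq unit_balls set0.
  by rewrite /polar_seminorm e !image_set0 sup0 addr0.
apply: ge_sup => [|_ [z zK <-]]; first by exists `|<<w + w', z0>>|, z0.
rewrite VS_pairingDl; apply: le_trans (ler_normD _ _) _.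
by apply: lerD; apply: (ub_le_sup (unit_balls_ubound _)); exists z.
Qed.

Lemma polar_unit_balls0 : polar_seminorm (VS_pairing R GG) unit_balls 0 <= 0.
Proof. by apply: polar_le => // z _; rewrite VS_pairing0l normr0. Qed.

Lemma strongly_bounded_sums (B : set (VS_space R GG)) :
  bounded_for (strong_seminorms (VS_pairing R GG)) B ->
  exists2 C : R, 0 <= C & forall w, B w -> all_sum_le GG (val w) C.
Proof.
pose q := polar_seminorm (VS_pairing R GG) unit_balls.
have qs : strong_seminorms (VS_pairing R GG) q.
  by exists unit_balls => //; exact: unit_balls_bounded.
move=> Bb; have [r r0 Hr] := Bb _ (nbhs_seminorm_ball _ _ q 0 1 qs
  polar_unit_ballsD polar_unit_balls0 ltr01).
exists r; first exact: ltW.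
move=> w Bw A GA; have [|u /= + <-] := Hr r _ w Bw; first exact: ler_norm.
rewrite subr0 => /ltW qu.
have uA : sum_le A (val u) 1.
  apply/sum_le_pk => //; apply: le_trans qu; apply: polar_sum_le => //.
    by move=> z zA; exists A.
  exact: unit_balls_ubound.
apply: (@sum_le_dom _ _ _ _ (fun x => r * val u x)).
  by move=> x _; rewrite subspZ.
by rewrite -[X in sum_le _ _ X]mulr1 -{2}(gtr0_norm r0); exact: sum_leZ.
Qed.

(** Finitely many weak balls around a cluster point of the filter of tails form one
    neighbourhood of it, so they share terms of arbitrarily large index. *)
Lemma compact_seq_clusters (K : set (VS_dual R GG)) :
  compact (K : set (seminorm_top (weak_seminorms (VS_pairing R GG)))) ->
  seq_clusters GG (@subsp_val _ _ _ @` K).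
Proof.
move=> cK y Ky.
have /boolp.choice[z Hz] n : exists z, K z /\ subsp_val z = y n.
  by have [z] := Ky n; exists z.
have zK n : K (z n) by have [] := Hz n.
have zy n : subsp_val (z n) = y n by have [] := Hz n.
pose zz : nat -> seminorm_top (weak_seminorms (VS_pairing R GG)) := z.
have zzK : (zz @ \oo) K by exists 0%N => // n _; exact: zK.
have [p [Kp pcl]] := cK (zz @ \oo) _ zzK.
exists (val p); first exact: VS_dualP.
move=> D finD DV e e0 N.
have nbD : nbhs p [set u : VS_dual R GG |
    forall v, D v -> `|pairing v (val u) - pairing v (val p)| < e].
  apply: (near_finite_set (nbhs p) D) => // v /DV/mem_VS vV.
  pose w : VS_space R GG := Subsp vV.
  have : nbhs p [set u : VS_dual R GG | `|<<w, u - p>>| < e].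
    apply: (nbhs_seminorm_ball _ _ (fun u => `|<<w, u>>|)) => //.
    - by exists w.
    - by move=> u u'; rewrite VS_pairingDr ler_normD.
    - by rewrite VS_pairing0r normr0.
  apply: filterS => u /=; suff -> : <<w, u - p>> = pairing v (val u) - pairing v (val p).
    by [].
  by rewrite -scaleN1r VS_pairingDr VS_pairingZr mulN1r.
have tail : (zz @ \oo) [set u : VS_dual R GG | exists2 n, (N <= n)%N & u = z n].
  by exists N => // n /= Nn; exists n.
have [_ [[n Nn ->] Hn]] := pcl _ _ tail nbD.
by exists n => // v Dv; rewrite -zy; exact: Hn.
Qed.

Hypothesis GG_countable : countable GG.
Hypothesis GG_locfin : forall x, finite_set [set A | GG A /\ A x].
Hypothesis GG_cover : \bigcup_(A in GG) A = [set: V].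

Lemma nbhs_pk_ball A w (e : R) : GG A -> 0 < e ->
  nbhs (w : seminorm_top (p_seminorms R GG)) [set y | pk A (y - w) < e].
Proof.
move=> GA e0; apply: nbhs_seminorm_ball => //.
- by exists A.
- by move=> y z; exact: pkD.
- exact: pk0.
Qed.

(** Since the family is countable, a failure would be witnessed by a sequence
    y n - x in B - x, whose sums tend to 0 over each A, paired with a sequence
    in K; B - x has sums bounded by 2 C. *)
Lemma nbhs_mackey_ball (K : set (VS_dual R GG)) (B : set (VS_space R GG))
    (C : R) (x : VS_space R GG) (e : R) :
  compact (K : set (seminorm_top (weak_seminorms (VS_pairing R GG)))) ->
  0 <= C -> (forall w, B w -> all_sum_le GG (val w) C) -> B x -> 0 < e ->
  nbhs (x : seminorm_top (p_seminorms R GG))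
    [set y | B y -> polar_seminorm (VS_pairing R GG) K (y - x) < e].
Proof.
move=> cK C0 BC Bx e0; apply: contrapT => nn.
have /countable_injP[f finj] := GG_countable.
have /boolp.choice[y Hy] : forall n : nat, exists y : VS_space R GG,
    [/\ forall A, GG A /\ (f A < n)%N -> pk A (y - x) < n.+1%:R^-1, B y &
        e <= polar_seminorm (VS_pairing R GG) K (y - x)].
  move=> n; apply: contrapT => Hn; apply: nn.
  have : nbhs (x : seminorm_top (p_seminorms R GG)) [set y : VS_space R GG |
      forall A, (GG A /\ (f A < n)%N) -> pk A (y - x) < n.+1%:R^-1].
    apply: (near_finite_set (nbhs (x : seminorm_top (p_seminorms R GG)))
      [set A | GG A /\ (f A < n)%N]).
      have inj : {in [set A | GG A /\ (f A < n)%N] &, injective f}.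
        by move=> A A' /set_mem[GA _] /set_mem[GA' _]; apply: finj; apply: mem_set.
      rewrite -(eq_finite_set (inj_card_eq inj)).
      by apply: sub_finite_set (finite_II n) => _ [A [_ fA] <-].
    by move=> A [GA _]; apply: nbhs_pk_ball => //; rewrite invr_gt0.
  apply: filterS => y Hy By; rewrite ltNge; apply/negP => ey.
  by apply: Hn; exists y.
have e2 : 0 < e / 2 by rewrite divr_gt0.
have /boolp.choice[z Hz] : forall n, exists z : VS_dual R GG,
    K z /\ e / 2 <= `|<<y n - x, z>>|.
  move=> n; apply: contrapT => Hn; have [_ _] := Hy n; apply/negP; rewrite -ltNge.
  apply: (@le_lt_trans _ _ (e / 2)); last by rewrite gtr_pMr// invf_lt1// ltr1n.
  apply: polar_le => [|u uK]; first exact: ltW.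
  by rewrite leNgt; apply/negP => /ltW eu; apply: Hn; exists u.
pose w n := val (y n - x).
have [|||||||n] := uniformly_null GG GG_locfin GG_cover
    (@subsp_val _ _ _ @` K) w (fun n => val (z n)) (C + C) (e / 2).
- by move=> _ [u _ <-]; exact: VS_dualP.
- exact: compact_seq_clusters.
- exact: addr_ge0.
- move=> n A GA; have [_ By _] := Hy n.
  apply: (@sum_le_dom _ _ _ _ (fun g => val (y n) g + -1 * val x g)).
    by move=> g _; rewrite /w subspB mulN1r.
  apply: sum_leD; first exact: BC.
  rewrite -[X in sum_le _ _ X]mul1r -{2}(normr1 R) -normrN; apply: sum_leZ.
  exact: BC.
- move=> A GA d d0.
  have : \forall n \near \oo, n.+1%:R^-1 <= d.
    by apply: filterS (near_infty_natSinv_lt (PosNum d0)) => n /ltW.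
  have : \forall n \near \oo, (f A < n)%N by exists (f A).+1.
  apply: filterS2 => n fn dn; have [/(_ A (conj GA fn)) lt _ _] := Hy n.
  by apply/sum_le_pk => //; apply: le_trans dn; exact: ltW.
- by move=> n; exists (z n) => //; have [] := Hz n.
- by [].
- by rewrite ltNge; have [_ ->] := Hz n.
Qed.

End Strong.

Theorem corollary2p12 (R : realType) (V : choiceType) (GG : set (set V))
    (GG_countable : countable GG)
    (G_countable : forall A, GG A -> countable A)
    (GG_cover : \bigcup_(A in GG) A = [set: V])
    (g1 : cond_g1 GG) (g2 : cond_g2 GG) :
  let T := opens (p_seminorms R GG) in
  let T_m := opens (mackey_seminorms (VS_pairing R GG)) in
  T `<=` T_m /\
  (forall B : set (VS_space R GG),
     bounded_for (strong_seminorms (VS_pairing R GG)) B ->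
     traces T_m B = traces T B).
Proof.
move=> T T_m.
have TTm : T `<=` T_m.
  rewrite /T /T_m !opensE => W oW x /oW[F [e [finF FP e0 FW]]]; exists F, e; split => //.
  by move=> p /FP; exact: p_seminorms_mackey.
split=> // B /strongly_bounded_sums[C C0 BC].
have locfin x : finite_set [set A | GG A /\ A x].
  by apply/finite_set_leP; exists 2; exact: g1.
apply/seteqP; split=> [_ [W oW <-]|_ [W oW <-]]; last by exists W => //; exact: TTm.
(* It is enough that W `|` ~` B is a neighbourhood of each point of W `&` B. *)
pose X : set (seminorm_top (p_seminorms R GG)) := W `|` ~` B.
exists (interior X); first exact: open_interior.
apply/seteqP; split=> x [Wx Bx]; split=> //.
  by have [] : X x by exact: interior_subset Wx.
rewrite /T_m opensE in oW.
have [F [e [finF FP e0 FW]]] := oW x Wx.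
have : nbhs (x : seminorm_top (p_seminorms R GG))
    [set y | forall p, F p -> B y -> p (y - x) < e].
  apply: (near_finite_set (nbhs (x : seminorm_top (p_seminorms R GG))) F
    (fun p y => B y -> p (y - x) < e)) => // _ /FP[K [_ cK] <-].
  exact: (nbhs_mackey_ball GG GG_countable locfin GG_cover K B C).
apply: filterS => y Hy; case: (pselect (B y)) => [By|]; last by right.
by left; apply: FW => p Fp; exact: Hy.
Qed.
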